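(* If $a\equiv3\pmod4$, then $n\mapsto\kappa_a(n)=\left(\frac{a}{n}\right)$ (Kronecker symbol) is a mock character of mockulus $2$.
   Context: For an integer $q\ge2$, a sequence $(\alpha(n))_{n\ge0}$ is $q$-automatic if its $q$-kernel $\{(\alpha(q^km+r))_{m\ge0}: k\ge0,\ 0\le r<q^k\}$ is finite. A map $\kappa:\mathbb{Z}\to\mathbb{C}$ is a mock character of mockulus $q$ if (i) $\kappa$ is completely multiplicative; (ii) $(\kappa(n))_{n\ge0}$ is $q$-automatic but not eventually periodic; and (iii) there exists an integer $d\ge1$ with $\kappa(n)=0$ precisely when $n=0$ or $\gcd(n,d)\ne1$. Kronecker symbol, with $-1$ regarded as a prime: $\left(\frac{a}{n}\right)=0$ whenever $an=0$ or $\gcd(|a|,|n|)>1$; otherwise write $n=\prod_p p^{\nu_p}$ over primes $p$ (including $p=-1$) and set $\left(\frac{a}{n}\right)=\prod_p\left(\frac{a}{p}\right)^{\nu_p}$, where for primes $p\ge3$ it is the Legendre symbol, for $a$ odd $\left(\frac{a}{2}\right)=(-1)^{(a^2-1)/8}$, and $\left(\frac{a}{-1}\right)=\operatorname{sign}(a)$. *)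

(* Defs.v *)
From mathcomp Require Import all_boot all_order all_algebra.
From mathcomp Require Import classical_sets cardinality reals.
From mathcomp.real_closed Require Export complex.

Set Implicit Arguments.
Unset Strict Implicit.
Unset Printing Implicit Defensive.

Import Order.TTheory GRing.Theory Num.Theory.

Local Open Scope classical_set_scope.
Local Open Scope ring_scope.

Definition q_kernel (T : Type) (q : nat) (alpha : nat -> T) : set (nat -> T) :=
  [set s | exists k r : nat,
     (r < q ^ k)%N /\ s = (fun m : nat => alpha (q ^ k * m + r)%N)].

Definition automatic (T : Type) (q : nat) (alpha : nat -> T) : Prop :=
  (2 <= q)%N /\ finite_set (q_kernel q alpha).

Definition eventually_periodic (T : Type) (alpha : nat -> T) : Prop :=
  exists N p : nat,
    (0 < p)%N /\ forall n : nat, (N <= n)%N -> alpha (n + p)%N = alpha n.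

Definition completely_multiplicative (S : nzRingType) (f : int -> S) : Prop :=
  f 1 = 1 /\ forall m n : int, f (m * n) = f m * f n.

Definition mock_character (R : realType) (q : nat) (kappa : int -> R[i]) : Prop :=
  [/\ completely_multiplicative kappa,
      automatic q (fun n : nat => kappa n%:Z),
      ~ eventually_periodic (fun n : nat => kappa n%:Z)
    & exists d : nat, (1 <= d)%N /\
        forall n : int, kappa n = 0 <-> n = 0 \/ gcdn `|n| d <> 1%N].

(* Meaningful for p an odd prime. *)
Definition legendre (a : int) (p : nat) : int :=
  if (p %| a)%Z then 0
  else if [exists x : 'I_p, (x%:Z ^+ 2 == a %[mod p])%Z] then 1 else -1.

(* The symbol (a/p) for a positive prime p.  The value at p = 2 is meaningful
   for a odd; for a even, [kronecker] never uses it. *)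
Definition kronecker_prime (a : int) (p : nat) : int :=
  if p == 2%N then (-1) ^+ ((`|a| ^ 2 - 1) %/ 8)%N else legendre a p.

(* The factor [sgz a ^+ (n < 0)%R] is the contribution (a/-1)^nu of the
   prime -1, whose exponent nu in n is 1 if n < 0 and 0 otherwise. *)
Definition kronecker (a n : int) : int :=
  if (a * n == 0) || (1 < gcdn `|a| `|n|)%N then 0
  else sgz a ^+ (n < 0)%R
       * \prod_(p <- primes `|n|) kronecker_prime a p ^+ logn p `|n|.

(* Main.v *)
(** For odd [n > 0], the symbol [(a/n)] is a Jacobi symbol, and quadratic
    reciprocity with [a = 3 mod 4] gives [(a/n) = (-1)^((n-1)/2) (n/|a|)] for
    either sign of [a]; hence [(a/(n + 2|a|)) = - (a/n)].  So kappa has period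
    [4|a|] on odd integers; together with [kappa(2n) = kappa(2) kappa(n)] every
    kernel element is either [+- kappa] or [4|a|]-periodic, and there are
    finitely many of those.  If kappa were eventually periodic, then since
    [kappa(2) <> 0] the period could be halved until it is odd, say [p]; the
    shift by [2|a|p] would then both preserve and negate the values at odd [n].

    Reciprocity comes from the Gauss sum [G] of the quadratic character mod [q]
    in a finite field of characteristic [p]: [G^2 = (-1/q) q] and
    [G^p = (p/q) G]. *)

Require Import Defs.
From mathcomp Require Import all_boot all_order all_algebra all_solvable all_field zify.
From mathcomp Require Import boolp classical_sets cardinality reals.

Set Implicit Arguments.
Unset Strict Implicit.
Unset Printing Implicit Defensive.

Import Order.TTheory GRing.Theory Num.Theory.

Local Open Scope ring_scope.

(** * Integers in a ring of characteristic [p], and the values 0, 1, -1 *)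

Lemma dvdn_pcharz (R : nzRingType) (p : nat) (m : int) :
  p \in [pchar R] -> (p %| m)%Z = (m%:~R == 0 :> R).
Proof.
move=> pR; rewrite dvdzE absz_nat (dvdn_pcharf pR).
by case: m => n //; rewrite NegzE abszN absz_nat mulrNz oppr_eq0.
Qed.

Definition trit (x : int) : bool := x \in [:: 0; 1; -1].

Lemma tritM x y : trit x -> trit y -> trit (x * y).
Proof.
by rewrite /trit !inE => /or3P[] /eqP-> /or3P[] /eqP->.
Qed.

Lemma tritX x n : trit x -> trit (x ^+ n).
Proof. by move=> tx; elim: n => // n IH; rewrite exprS tritM. Qed.

(** Lifts identities between symbols, computed in a field, back to the integers: 0, 1 and -1 stay
    distinct once 2 is nonzero. *)
Lemma trit_inj (R : nzRingType) (x y : int) :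
  (2 : R) != 0 -> trit x -> trit y -> x%:~R = y%:~R :> R -> x = y.
Proof.
move=> R2; have H : (1 : R) <> -1.
  by move/eqP; rewrite -subr_eq0 opprK => /eqP h; case/eqP: R2.
have H1 : (1 : R) <> 0 by apply/eqP/oner_neq0.
rewrite /trit !inE => /or3P[] /eqP-> /or3P[] /eqP-> //=;
  rewrite ?mulrNz ?mulr0z ?mulr1z //.
- by move/esym.
- by move/esym/eqP; rewrite oppr_eq0 => /eqP.
- by move/eqP; rewrite oppr_eq0 => /eqP.
- by move/esym.
Qed.

(** * The quadratic character of a finite field *)

Section QuadraticCharacter.

Variable F : finFieldType.

Definition qchar (x : F) : int :=
  if x == 0 then 0 else if [exists y, y ^+ 2 == x] then 1 else -1.

Lemma trit_qchar x : trit (qchar x).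
Proof. by rewrite /qchar; case: ifP => // _; case: ifP. Qed.

Lemma qchar0 : qchar 0 = 0.
Proof. by rewrite /qchar eqxx. Qed.

Lemma qchar_eq0 x : (qchar x == 0) = (x == 0).
Proof. by rewrite /qchar; case: ifP => // _; case: ifP. Qed.

Lemma qchar_sqr x : x != 0 -> qchar x * qchar x = 1.
Proof. by rewrite /qchar => /negPf->; case: ifP. Qed.

Lemma expf_card1 (x : F) : x != 0 -> x ^+ #|F|.-1 = 1.
Proof.
move=> x0; apply: (mulfI x0); rewrite -exprS mulr1 prednK ?expf_card //.
exact: ltnW (finNzRing_gt1 F).
Qed.

Lemma finField_prim_root : exists z : F, (#|F|.-1).-primitive_root z.
Proof.
have Fgt := finNzRing_gt1 F.
have h : has (#|F|.-1).-primitive_root (enum [pred x : F | x != 0]).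
  apply: has_prim_root.
  - by rewrite -ltnS prednK // ltnW.
  - by apply/allP => x; rewrite mem_enum inE unity_rootE => /expf_card1->.
  - exact: enum_uniq.
  - by rewrite -cardE -(cardC (pred1 (0 : F))) card1.
by have /hasP[z _ prz] := h; exists z.
Qed.

Hypothesis oddF : odd #|F|.

Lemma half_card : (#|F|.-1 = #|F|./2 * 2)%N.
Proof. by rewrite -{1}(odd_double_half #|F|) oddF muln2. Qed.

(** Translation by 1 permutes [F], so the sum of all elements is unchanged by adding [#|F|], which
    is therefore 0 in [F]. Since [#|F|] is odd, 2 = 0 would give 1 = 0. *)
Lemma neq2_0 : (2 : F) != 0.
Proof.
have: \sum_(x : F) x == \sum_(x : F) x + #|F|%:R.
  rewrite {1}(reindex_inj (addIr 1)) big_split; apply/eqP; congr (_ + _).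
  by rewrite -sum1_card natr_sum.
rewrite addrC -subr_eq subrr -(odd_double_half #|F|) oddF -mul2n natrD natrM.
by apply: contraTneq => ->; rewrite mul0r addr0 eq_sym oner_eq0.
Qed.

Lemma euler_criterion (x : F) : x ^+ #|F|./2 = (qchar x)%:~R.
Proof.
have h0 : (0 < #|F|./2)%N.
  by move: (finNzRing_gt1 F) oddF; case: #|F| => [|[|[|n]]].
rewrite /qchar; have [->|x0] := eqVneq x 0; first by rewrite expr0n gtn_eqF.
case: existsP => [[y /eqP yx]|nsq].
  rewrite -yx -exprM mulnC -half_card expf_card1 //.
  by apply: contra_neq x0 => y0; rewrite -yx y0 expr0n.
have /eqP : (x ^+ #|F|./2) ^+ 2 = 1 by rewrite -exprM -half_card expf_card1.
rewrite sqrf_eq1 => /orP[] /eqP // h.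
(* It remains to exclude the power 1 for a nonsquare. With [x = z ^+ i] and [z] of order twice
   [#|F|./2], it would force [i] to be even. *)
have [z prz] := finField_prim_root.
have [i xi] := prim_rootP prz (expf_card1 x0).
move/eqP: h; rewrite xi -exprM -(prim_order_dvd prz) [X in (X %| _)%N]half_card mulnC.
rewrite dvdn_pmul2r // => /dvdnP[k ki].
by case: nsq; exists (z ^+ k); rewrite -exprM -ki xi.
Qed.

Lemma qcharM x y : qchar (x * y) = qchar x * qchar y.
Proof.
apply: (trit_inj neq2_0); rewrite ?tritM ?trit_qchar //.
by rewrite intrM -!euler_criterion exprMn.
Qed.

Lemma qchar1 : qchar 1 = 1.
Proof.
by rewrite /qchar oner_eq0; case: existsP => // -[]; exists 1; rewrite expr1n.
Qed.

(** By Euler's criterion a generator that is a square would have order dividing [#|F|./2], which is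
    too small. *)
Lemma qchar_nonsquare : exists u, qchar u = -1.
Proof.
have [z prz] := finField_prim_root; exists z.
have z0 : z != 0.
  rewrite (prim_root_eq0 prz); rewrite -lt0n -ltnS prednK ?finNzRing_gt1 //.
  exact: ltnW (finNzRing_gt1 F).
move: (euler_criterion z); rewrite /qchar (negPf z0); case: ifP => // _ /eqP.
rewrite -(prim_order_dvd prz) => /dvdn_leq.
by have : (1 < #|F|)%N := finNzRing_gt1 F; move: oddF; lia.
Qed.

(** Multiplication by a nonsquare permutes [F] and negates every term. *)
Lemma sum_qchar : \sum_x qchar x = 0.
Proof.
have [u hu] := qchar_nonsquare.
have u0 : u != 0 by rewrite -qchar_eq0 hu.
have: \sum_x qchar x = - \sum_x qchar x.
  rewrite {1}(reindex_inj (mulfI u0)) -sumrN.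
  by apply: eq_bigr => x _; rewrite qcharM hu mulN1r.
by move/eqP; rewrite -addr_eq0 -mulr2n mulrn_eq0 /= => /eqP.
Qed.

End QuadraticCharacter.

(** * Gauss sums of the quadratic character against an injective additive character [e] *)

Section GaussSum.

Variables (F : finFieldType) (L : fieldType) (e : F -> L).
Hypotheses (oddF : odd #|F|) (eD : forall x y, e (x + y) = e x * e y).
Hypothesis e_eq1 : forall x, (e x == 1) = (x == 0).

(** Replacing [x] by [x + 1] multiplies the sum by [e t], which differs from 1 unless [t] is 0. *)
Lemma sum_additive_char (t : F) :
  \sum_x e (x * t) = if t == 0 then #|F|%:R else 0.
Proof.
have e0 : e 0 = 1 by apply/eqP; rewrite e_eq1.
case: eqVneq => [->|t0].
  by rewrite -sum1_card natr_sum; apply: eq_bigr => x _; rewrite mulr0 e0.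
apply/eqP; have : (\sum_x e (x * t)) * (e t - 1) == 0.
  rewrite mulrBr mulr1 subr_eq0 mulr_suml; apply/eqP.
  rewrite [RHS](reindex_inj (addIr 1)); apply: eq_bigr => x _.
  by rewrite mulrDl mul1r eD.
by rewrite mulf_eq0 subr_eq0 e_eq1 (negPf t0) orbF.
Qed.

Definition gauss_sum : L := \sum_x (qchar x)%:~R * e x.

(** Writing the second variable as [x * m] cancels the character of [x]. Orthogonality then
    evaluates the sum over nonzero [x] as [#|F|] at [m = -1], minus 1 throughout; the constant drops
    out by [sum_qchar]. *)
Lemma gauss_sum_sqr : gauss_sum ^+ 2 = (qchar (-1 : F))%:~R * #|F|%:R.
Proof.
have e0 : e 0 = 1 by apply/eqP; rewrite e_eq1.
have -> : gauss_sum ^+ 2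
    = \sum_m (qchar m)%:~R * \sum_(x | x != 0) e (x * (1 + m)).
  transitivity (\sum_(x | x != 0) \sum_m (qchar m)%:~R * e (x * (1 + m))).
    rewrite expr2 {1}/gauss_sum mulr_suml (bigD1 0) //= qchar0 !mul0r add0r.
    apply: eq_bigr => x x0; rewrite /gauss_sum (reindex_inj (mulfI x0)) mulr_sumr.
    apply: eq_bigr => m _; rewrite mulrDr mulr1 eD qcharM //.
    by rewrite mulrACA -intrM [X in X%:~R]mulrA qchar_sqr // mul1r.
  by rewrite exchange_big; apply: eq_bigr => m _; rewrite mulr_sumr.
have inner m : \sum_(x | x != 0) e (x * (1 + m))
    = (if m == -1 then #|F|%:R else 0) - 1.
  have := sum_additive_char (1 + m).
  by rewrite (bigD1 0) //= mul0r e0 addrC [1 + m]addrC addr_eq0 => <-; rewrite addrK.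
under eq_bigr do rewrite inner mulrBr mulr1.
rewrite sumrB -[X in _ - X](raddf_sum (intmul 1)) sum_qchar // subr0.
rewrite (bigD1 (-1)) //= eqxx big1 ?addr0 // => m /negPf->.
by rewrite mulr0.
Qed.

(** The [p]-th power is additive in [L], fixes the character values as [p] is odd, and sends [e x]
    to [e (p x)]; reindexing by [p x] pulls out the character of [p]. *)
Lemma gauss_sum_frobenius (p : nat) : odd p -> p \in [pchar L] -> p%:R != 0 :> F ->
  gauss_sum ^+ p = (qchar (p%:R : F))%:~R * gauss_sum.
Proof.
move=> oddp pL p0.
have eM n x : e (n%:R * x) = e x ^+ n.
  elim: n => [|n IH]; first by apply/eqP; rewrite mul0r expr0 e_eq1.
  by rewrite exprS -IH -eD mulrS mulrDl mul1r.
have chiX x : (qchar (x : F))%:~R ^+ p = (qchar x)%:~R :> L.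
  have := trit_qchar x; rewrite /trit !inE => /or3P[] /eqP->.
  - by rewrite expr0n; case: (p) oddp.
  - by rewrite expr1n.
  - by rewrite -signr_odd oddp.
rewrite -(pFrobenius_autE pL) /gauss_sum rmorph_sum mulr_sumr.
rewrite [RHS](reindex_inj (mulfI p0)); apply: eq_bigr => x _.
rewrite [LHS]pFrobenius_autE exprMn chiX eM mulrA -intrM qcharM //.
by rewrite [qchar p%:R * _]mulrA qchar_sqr // mul1r.
Qed.

End GaussSum.

(** * The Legendre symbol and quadratic reciprocity for primes *)

(** By Euler's theorem [q] divides [p ^ totient q - 1], so the cyclic group of units of the field of
    that size has an element of order [q]. *)
Lemma exists_prim_root_pchar (p q : nat) : prime p -> coprime p q -> (0 < q)%N ->
  exists (L : finFieldType) (z : L), p \in [pchar L] /\ q.-primitive_root z.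
Proof.
move=> pp cpq q0; have tq : (0 < totient q)%N by rewrite totient_gt0.
have [L pL cL] := pPrimePowerField pp tq.
have [z prz] := finField_prim_root L.
have dq : (q %| #|L|.-1)%N.
  rewrite cL -subn1 -eqn_mod_dvd ?expn_gt0 ?prime_gt0 //.
  by apply/eqP/Euler_exp_totient.
exists L, (z ^+ (#|L|.-1 %/ q)); split=> //.
by rewrite (dvdn_prim_root prz).
Qed.

Lemma legendreE (p : nat) (a : int) : prime p -> legendre a p = qchar (a%:~R : 'F_p).
Proof.
move=> pp; have pF := pchar_Fp pp.
rewrite /legendre /qchar (dvdn_pcharz a pF); case: ifP => // _.
congr (if _ then _ else _); apply/existsP/existsP => -[x].
  rewrite eqz_mod_dvd (dvdn_pcharz _ pF) rmorphB /= subr_eq0 => h.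
  by exists x%:R; rewrite rmorphXn in h.
move=> h; have xp : (x < p)%N by rewrite -[X in (_ < X)%N](Fp_cast pp) ltn_ord.
exists (Ordinal xp); rewrite eqz_mod_dvd (dvdn_pcharz _ pF) rmorphB /= subr_eq0.
by rewrite rmorphXn /= -pmulrn natr_Zp.
Qed.

Lemma odd_card_Fp (p : nat) : prime p -> odd p -> odd #|'F_p|.
Proof. by move=> pp; rewrite card_Fp. Qed.

Lemma trit_legendre a p : trit (legendre a p).
Proof. by rewrite /legendre; case: ifP => // _; case: ifP. Qed.

Lemma legendreM (p : nat) (a b : int) : prime p -> odd p ->
  legendre (a * b) p = legendre a p * legendre b p.
Proof.
by move=> pp op; rewrite !legendreE // intrM qcharM //; apply: odd_card_Fp.
Qed.

Lemma legendre1 (p : nat) : prime p -> odd p -> legendre 1 p = 1.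
Proof. by move=> pp op; rewrite legendreE // qchar1. Qed.

Lemma legendre_mod (p : nat) (a b : int) : (a = b %[mod p])%Z ->
  legendre a p = legendre b p.
Proof.
move=> ab; rewrite /legendre.
by rewrite !(sameP dvdz_mod0P eqP) ab; case: ifP => // _; congr (if _ then _ else _);
  by apply: eq_existsb => x; rewrite ab.
Qed.

(** Euler's criterion in ['F_p] is a divisibility by [p], hence carries over to any ring of
    characteristic [p], in particular to the field containing the Gauss sum. *)
Lemma legendre_euler (R : nzRingType) (p : nat) (a : int) : odd p ->
  p \in [pchar R] -> (a%:~R : R) ^+ p./2 = (legendre a p)%:~R.
Proof.
move=> op pR; have pp := pcharf_prime pR.
apply/eqP; rewrite -rmorphXn /= -subr_eq0 -rmorphB -(dvdn_pcharz _ pR).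
rewrite (dvdn_pcharz _ (pchar_Fp pp)) rmorphB rmorphXn /= subr_eq0 legendreE //.
by rewrite -euler_criterion ?odd_card_Fp // card_Fp.
Qed.

Lemma pchar_neq2_0 (R : nzRingType) (p : nat) : odd p -> p \in [pchar R] ->
  (2 : R) != 0.
Proof.
move=> op pR; rewrite -(dvdn_pcharf pR) dvdn_prime2 ?(pcharf_prime pR) //.
by apply: contraTneq op => ->.
Qed.

Lemma legendreN1 (p : nat) : prime p -> odd p -> legendre (-1) p = (-1) ^+ p./2.
Proof.
move=> pp op; have pF := pchar_Fp pp.
apply: (trit_inj (pchar_neq2_0 op pF)); rewrite ?trit_legendre ?tritX //.
by rewrite -(legendre_euler _ op pF) rmorphXn.
Qed.

Theorem quadratic_reciprocity (p q : nat) : prime p -> prime q -> odd p -> odd q ->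
  legendre q p = legendre p q * (-1) ^+ (p./2 * q./2).
Proof.
move=> pp pq op oq; have [<-|npq] := eqVneq p q.
  (* For [p = q] both symbols vanish. *)
  by rewrite legendreE // -pmulrn pchar_Fp_0 // qchar0 mul0r.
have cpq : coprime p q by rewrite prime_coprime // dvdn_prime2.
have [L [z [pL prz]]] := exists_prim_root_pchar pp cpq (prime_gt0 pq).
pose e (x : 'F_q) := z ^+ x.
have cF : #|'F_q| = q := card_Fp pq.
have oF : odd #|'F_q| by rewrite cF.
have eD x y : e (x + y) = e x * e y.
  rewrite /e -exprD; apply/eqP; rewrite (eq_prim_root_expr prz).
  rewrite -[in X in X == _](natr_Zp x) -[in X in X == _](natr_Zp y) -natrD.
  by rewrite val_Fp_nat // modn_mod.
have e1 x : (e x == 1) = (x == 0).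
  rewrite -(prim_order_dvd prz) -[in LHS](natr_Zp x) val_Fp_nat //.
  by rewrite -[in RHS](natr_Zp x) -(dvdn_pcharf (pchar_Fp pq)) /dvdn modn_mod.
have p0 : p%:R != 0 :> 'F_q.
  by rewrite -(dvdn_pcharf (pchar_Fp pq)) dvdn_prime2 // eq_sym.
have := gauss_sum_sqr oF eD e1; set G := gauss_sum e => G2.
have Gp := gauss_sum_frobenius oF eD e1 op pL p0.
rewrite -/G cF in G2 Gp.
have qL : (q%:R : L) != 0 by rewrite -(dvdn_pcharf pL) dvdn_prime2.
have chiN1 : qchar (-1 : 'F_q) = (-1) ^+ q./2 by rewrite -legendreN1 // legendreE.
have G0 : G != 0.
  have : G ^+ 2 != 0.
    by rewrite G2 chiN1 mulf_neq0 // rmorphXn expf_neq0 // oppr_eq0 oner_neq0.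
  by apply: contraNneq => ->; rewrite expr0n.
(* Two values of [G ^+ p] are compared: Frobenius gives [(p/q) G], while [G * (G ^+ 2) ^+ p./2] is
   evaluated by Euler's criterion. Then [G] is cancelled. *)
have key : legendre ((-1) ^+ q./2 * q%:Z) p = legendre p q.
  apply: (trit_inj (pchar_neq2_0 op pL)); rewrite ?trit_legendre //.
  rewrite -(legendre_euler _ op pL) intrM -pmulrn -chiN1 -G2 -exprM.
  apply: (mulIf G0); rewrite -exprSr mulnC muln2 -add1n.
  have -> : (1 + p./2.*2)%N = p by rewrite -[RHS]odd_double_half op.
  by rewrite Gp legendreE.
rewrite -key legendreM //.
have -> : legendre ((-1) ^+ q./2) p = (-1) ^+ (p./2 * q./2).
  rewrite exprM -(legendreN1 pp op); elim: (q./2) => [|n IH].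
    by rewrite !expr0 legendre1.
  by rewrite !exprS legendreM // IH.
by rewrite mulrAC -exprD addnn -signr_odd odd_double mul1r.
Qed.

(** * Multiplicative extension from primes to positive integers *)

Lemma nat_prime_ind (P : nat -> Prop) : P 1%N ->
  (forall p m, prime p -> (0 < m)%N -> P m -> P (p * m)%N) ->
  forall n, (0 < n)%N -> P n.
Proof.
move=> P1 PM; elim/ltn_ind => n IH n0.
have [n1|n1] := leqP n 1; first by have -> : n = 1%N by lia.
have dn := pdiv_dvd n; have pn := pdiv_prime n1.
have q0 : (0 < n %/ pdiv n)%N by rewrite divn_gt0 ?pdiv_gt0 // dvdn_leq.
have nE : n = (pdiv n * (n %/ pdiv n))%N by rewrite mulnC divnK.
rewrite nE; apply: PM => //; apply: IH => //.
by rewrite ltn_Pdiv ?prime_gt1.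
Qed.

(** The common shape of the Jacobi symbol and of the product in [kronecker], so that
    multiplicativity is proved once. *)
Definition mulext (f : nat -> int) (n : nat) : int :=
  \prod_(p <- primes n) f p ^+ logn p n.

Lemma mulext1 f : mulext f 1 = 1.
Proof. by rewrite /mulext big_nil. Qed.

Lemma mulext_prime f p : prime p -> mulext f p = f p.
Proof. by move=> pp; rewrite /mulext primes_prime // big_seq1 logn_prime // eqxx. Qed.

(** Primes outside [n] and nonprimes have exponent 0. A range common to several integers lets
    [mulextM] add exponents termwise. *)
Lemma mulext_widen f n N : (n < N)%N ->
  mulext f n = \prod_(0 <= p < N) f p ^+ logn p n.
Proof.
move=> nN; rewrite /mulext -(filter_pi_of nN) big_filter big_mkcond.
by apply: eq_bigr => p _; case: ifPn => //; rewrite /= -logn_gt0 lt0n negbK => /eqP->.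
Qed.

Lemma mulextM f m n : (0 < m)%N -> (0 < n)%N ->
  mulext f (m * n) = mulext f m * mulext f n.
Proof.
move=> m0 n0; pose N := (m * n).+1.
have mN : (m < N)%N by rewrite /N; nia.
have nN : (n < N)%N by rewrite /N; nia.
rewrite (mulext_widen f mN) (mulext_widen f nN) (@mulext_widen f _ N) //.
by rewrite -big_split; apply: eq_bigr => p _; rewrite lognM // exprD.
Qed.

Lemma eq_mulext f g n : (forall p, prime p -> (p %| n)%N -> f p = g p) ->
  mulext f n = mulext g n.
Proof.
move=> fg; rewrite /mulext big_seq [RHS]big_seq; apply: eq_bigr => p.
by rewrite mem_primes => /and3P[pp _ pn]; rewrite fg.
Qed.

Lemma mulext_mull f g n : mulext (fun p => f p * g p) n = mulext f n * mulext g n.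
Proof. by rewrite /mulext -big_split; apply: eq_bigr => p _; rewrite exprMn. Qed.

Lemma trit_mulext f n : (forall p, trit (f p)) -> trit (mulext f n).
Proof.
by move=> tf; apply: (big_ind trit) => // [x y|p _]; [exact: tritM | exact: tritX].
Qed.

Lemma mulext_eq0 f n : (0 < n)%N ->
  mulext f n = 0 <-> exists p, [/\ prime p, (p %| n)%N & f p = 0].
Proof.
move=> n0; split=> [|[p [pp pn f0]]].
  move/eqP; rewrite prodf_seq_eq0 => /hasP[p].
  rewrite mem_primes => /and3P[pp _ pn]; rewrite /= expf_eq0 => /andP[_ /eqP f0].
  by exists p.
have q0 : (0 < n %/ p)%N by rewrite divn_gt0 ?prime_gt0 // dvdn_leq.
rewrite -(divnK pn) (mulextM _ q0 (prime_gt0 pp)).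
by rewrite (mulext_prime _ pp) f0 mulr0.
Qed.

(** * The Jacobi symbol and its reciprocity law *)

Definition jacobi (a : int) (n : nat) : int := mulext (legendre a) n.

Lemma jacobi_n1 a : jacobi a 1 = 1.
Proof. exact: mulext1. Qed.

Lemma jacobi_prime a p : prime p -> jacobi a p = legendre a p.
Proof. exact: mulext_prime. Qed.

Lemma jacobi_mulr a m n : (0 < m)%N -> (0 < n)%N ->
  jacobi a (m * n) = jacobi a m * jacobi a n.
Proof. exact: mulextM. Qed.

Lemma odd_dvd d n : (d %| n)%N -> odd n -> odd d.
Proof. by move=> /dvdnP[k ->]; rewrite oddM => /andP[]. Qed.

Lemma jacobi_mull a b n : odd n -> jacobi (a * b) n = jacobi a n * jacobi b n.
Proof.
move=> on; rewrite -mulext_mull; apply: eq_mulext => p pp pn.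
by rewrite legendreM // (odd_dvd pn).
Qed.

Lemma jacobi1 n : odd n -> jacobi 1 n = 1.
Proof.
move=> on; rewrite /jacobi (@eq_mulext _ (fun=> 1)) /mulext.
  by rewrite big1 // => p _; rewrite expr1n.
by move=> p pp pn; rewrite legendre1 // (odd_dvd pn).
Qed.

Lemma jacobi_mod a b (n : nat) : (a = b %[mod n])%Z -> jacobi a n = jacobi b n.
Proof.
move=> ab; apply: eq_mulext => p pp pn; apply: legendre_mod; apply/eqP.
rewrite eqz_mod_dvd; apply: (@dvdz_trans n); first by rewrite dvdzE.
by rewrite -eqz_mod_dvd; apply/eqP.
Qed.

(** For [m = 2i + 1] and [n = 2j + 1], the half of [m n] is [i + j + 2ij], of the same parity as
    [i + j]. *)
Lemma expN1_half_mul m n : odd m -> odd n ->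
  (-1) ^+ (m * n)./2 = (-1) ^+ m./2 * (-1) ^+ n./2 :> int.
Proof.
move=> om on; rewrite -exprD -signr_odd -[RHS]signr_odd; congr (_ ^+ nat_of_bool _).
rewrite -(odd_double_half m) -(odd_double_half n) om on.
set i := m./2; set j := n./2.
have -> : ((true + i.*2) * (true + j.*2) = true + (i + j + (i * j).*2).*2)%N by nia.
by rewrite !half_bit_double oddD odd_double addbF.
Qed.

Lemma jacobiN1 n : odd n -> jacobi (-1) n = (-1) ^+ n./2.
Proof.
move=> on; have n0 : (0 < n)%N by case: n on.
elim/nat_prime_ind: n / n0 on => [|p m pp m0 IH]; first by rewrite jacobi_n1.
rewrite oddM => /andP[op om]; rewrite (jacobi_mulr _ (prime_gt0 pp) m0).
by rewrite (jacobi_prime _ pp) IH // legendreN1 // expN1_half_mul.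
Qed.

(** Both sides are multiplicative in each argument, the sign by [expN1_half_mul]. Induction on prime
    factors treats first a prime numerator, then a general one. *)
Theorem jacobi_reciprocity (m n : nat) : odd m -> odd n ->
  jacobi m n = jacobi n m * (-1) ^+ (m./2 * n./2).
Proof.
have prime_case (q : nat) k : prime q -> odd q -> odd k ->
    jacobi q k = legendre k q * (-1) ^+ (q./2 * k./2).
  move=> pq oq ok; have k0 : (0 < k)%N by case: k ok.
  elim/nat_prime_ind: k / k0 ok => [_|p l pp l0 IH].
    by rewrite jacobi_n1 legendre1 // muln0 mulr1.
  rewrite oddM => /andP[op ol]; rewrite (jacobi_mulr _ (prime_gt0 pp) l0).
  rewrite (jacobi_prime _ pp) IH // quadratic_reciprocity // PoszM legendreM //.
  by rewrite mulrACA !(mulnC q./2) !exprM expN1_half_mul // exprMn.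
move=> om on; have m0 : (0 < m)%N by case: m om.
elim/nat_prime_ind: m / m0 om => [_|p l pp l0 IH].
  by rewrite jacobi_n1 mul0n mulr1 jacobi1.
rewrite oddM => /andP[op ol]; rewrite PoszM jacobi_mull // IH // prime_case //.
rewrite (jacobi_mulr _ (prime_gt0 pp) l0) (jacobi_prime _ pp).
by rewrite mulrACA !exprM expN1_half_mul // exprMn.
Qed.

(** * The Kronecker symbol for [a] congruent to 3 modulo 4 *)

Section Kronecker.

Variable a : int.
Hypothesis ha : (a = 3 %[mod 4])%Z.

Lemma odd_absz_3mod4 : odd `|a|.
Proof. by move: ha; lia. Qed.

Lemma neq0_3mod4 : a != 0.
Proof. by move: ha; lia. Qed.

(** For [a > 0] the half of [|a|] is odd and the sign is that of reciprocity. For [a < 0], [|a|] is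
    1 modulo 4, reciprocity has no sign, and [(-1/n)] supplies it. *)
Lemma jacobi_3mod4 (n : nat) : odd n -> jacobi a n = (-1) ^+ n./2 * jacobi n `|a|.
Proof.
move=> on; have ob := odd_absz_3mod4.
have [a0|a0] := leP 0 a.
  rewrite -{1}(gez0_abs a0) jacobi_reciprocity // mulrC exprM.
  have -> : (-1) ^+ `|a|./2 = -1 :> int; last by [].
  by rewrite -signr_odd; have -> : odd `|a|./2 by move: ha a0; lia.
have -> : jacobi a n = jacobi (-1 * `|a|%:Z) n by congr jacobi; lia.
rewrite jacobi_mull // jacobiN1 // jacobi_reciprocity // mulrA exprM.
have -> : (-1) ^+ `|a|./2 = 1 :> int; last by rewrite expr1n mulr1.
by rewrite -signr_odd; have -> : odd `|a|./2 = false by move: ha a0; lia.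
Qed.

Lemma kronecker_prime_odd (p : nat) : odd p -> kronecker_prime a p = legendre a p.
Proof. by move=> op; rewrite /kronecker_prime ifN //; apply: contraTneq op => ->. Qed.

Lemma trit_kronecker_prime p : trit (kronecker_prime a p).
Proof.
by rewrite /kronecker_prime; case: ifP => _; rewrite ?trit_legendre // tritX.
Qed.

Lemma kronecker_prime_eq0 p : prime p -> (kronecker_prime a p == 0) = (p %| `|a|)%N.
Proof.
move=> pp; rewrite /kronecker_prime; case: (eqVneq p 2) => [->|_].
  by rewrite signr_eq0 dvdn2 odd_absz_3mod4.
by rewrite /legendre dvdzE absz_nat; case: ifP => // _; case: ifP.
Qed.

(** When the gcd exceeds 1, the product vanishes too, at any common prime. *)
Lemma kroneckerE (n : int) : n != 0 ->
  kronecker a n = sgz a ^+ (n < 0)%R * mulext (kronecker_prime a) `|n|.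
Proof.
move=> n0; rewrite /kronecker mulf_eq0 (negPf neq0_3mod4) (negPf n0) /=.
case: ifP => // g1.
suff -> : mulext (kronecker_prime a) `|n| = 0 by rewrite mulr0.
apply/mulext_eq0; first by rewrite absz_gt0.
exists (pdiv (gcdn `|a| `|n|)); have pp := pdiv_prime g1.
have := pdiv_dvd (gcdn `|a| `|n|); rewrite dvdn_gcd => /andP[da dn].
by split=> //; apply/eqP; rewrite kronecker_prime_eq0.
Qed.

Lemma kronecker0 : kronecker a 0 = 0.
Proof. by rewrite /kronecker mulr0. Qed.

Lemma kroneckerM m n : kronecker a (m * n) = kronecker a m * kronecker a n.
Proof.
have [->|m0] := eqVneq m 0; first by rewrite mul0r kronecker0 mul0r.
have [->|n0] := eqVneq n 0; first by rewrite mulr0 kronecker0 mulr0.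
rewrite !kroneckerE ?mulf_neq0 // abszM mulextM ?absz_gt0 // mulrACA; congr (_ * _).
have s2 : sgz a * sgz a = 1.
  by rewrite /sgz (negPf neq0_3mod4); case: ifP.
have -> : (m * n < 0) = (m < 0) (+) (n < 0).
  by move: m0 n0; case: (ltgtP m 0); case: (ltgtP n 0) => // *; nia.
by case: (m < 0); case: (n < 0); rewrite ?mulr1 ?mul1r.
Qed.

Lemma kronecker1 : kronecker a 1 = 1.
Proof. by rewrite kroneckerE // mulext1. Qed.

Lemma kronecker_eq0 n : kronecker a n = 0 <-> n = 0 \/ gcdn `|n| `|a| <> 1%N.
Proof.
have [->|n0] := eqVneq n 0; first by rewrite kronecker0; split=> // _; left.
have sn : sgz a ^+ (n < 0)%R != 0 by rewrite expf_neq0 // sgz_eq0 neq0_3mod4.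
have nn : (0 < `|n|)%N by rewrite absz_gt0.
rewrite kroneckerE //; split.
  move/eqP; rewrite mulf_eq0 (negPf sn) /= => /eqP/(mulext_eq0 _ nn)[p [pp pn /eqP]].
  rewrite kronecker_prime_eq0 // => pa; right => g1.
  by have := dvdn_gcd p `|n| `|a|; rewrite pn pa g1 dvdn1 => /eqP p1; rewrite p1 in pp.
case=> [/eqP|g1]; first by rewrite (negPf n0).
have g2 : (1 < gcdn `|n| `|a|)%N.
  by have : (0 < gcdn `|n| `|a|)%N; [rewrite gcdn_gt0 nn | lia].
have -> : mulext (kronecker_prime a) `|n| = 0; last by rewrite mulr0.
apply/mulext_eq0 => //; exists (pdiv (gcdn `|n| `|a|)); have pp := pdiv_prime g2.
have := pdiv_dvd (gcdn `|n| `|a|); rewrite dvdn_gcd => /andP[dn da].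
by split=> //; apply/eqP; rewrite kronecker_prime_eq0.
Qed.

Lemma trit_kronecker n : trit (kronecker a n).
Proof.
have [->|n0] := eqVneq n 0; first by rewrite kronecker0.
rewrite kroneckerE // tritM ?trit_mulext //; last exact: trit_kronecker_prime.
by rewrite tritX // /sgz; case: ifP => // _; case: ifP.
Qed.

(** The shift keeps [n] modulo [|a|] and adds the odd number [|a|] to [n./2]. *)
Lemma kronecker_odd_shift (n : nat) : odd n ->
  kronecker a (n + 2 * `|a|)%N%:Z = - kronecker a n%:Z.
Proof.
have kJ (k : nat) : odd k -> kronecker a k = (-1) ^+ k./2 * jacobi k `|a|.
  move=> ok; rewrite kroneckerE ?mul1r; last by case: k ok.
  rewrite -jacobi_3mod4 //; apply: eq_mulext => p _ pk.
  by rewrite kronecker_prime_odd // (odd_dvd pk).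
move=> on; have on2 : odd (n + 2 * `|a|) by rewrite oddD mul2n odd_double addbF.
rewrite !kJ // mul2n halfD on odd_double doubleK add0n exprD.
rewrite -[in X in _ * X * _]signr_odd odd_absz_3mod4 mulrN1 mulNr; congr (- (_ * _)).
by apply: jacobi_mod; rewrite -mul2n PoszD PoszM addrC modzMDl.
Qed.

Lemma kronecker_odd_period (n t : nat) : odd n ->
  kronecker a (n + 2 * `|a| * t)%N%:Z = (-1) ^+ t * kronecker a n.
Proof.
move=> on; elim: t => [|t IH]; first by rewrite muln0 addn0 mul1r.
rewrite mulnS addnCA addnC kronecker_odd_shift ?IH ?exprS ?mulN1r ?mulNr //.
by rewrite oddD on -mulnA mul2n odd_double.
Qed.

Lemma kronecker2_sqr : kronecker a 2 * kronecker a 2 = 1.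
Proof.
by rewrite kroneckerE // mulext_prime // mul1r -expr2 /kronecker_prime sqrr_sign.
Qed.

Lemma kronecker_double (n : nat) : kronecker a n.*2 = kronecker a 2 * kronecker a n.
Proof. by rewrite -kroneckerM -mul2n PoszM. Qed.

Lemma kronecker_not_periodic :
  ~ eventually_periodic (fun n : nat => kronecker a n%:Z).
Proof.
move=> [N [p [p0 per]]].
elim/ltn_ind: p p0 per => p IH p0 per.
have [op|ep] := boolP (odd p); last first.
  (* An even period is halved with the same [N]: periodicity at [n.*2] descends to [n] after
     cancelling the value at 2. *)
  have pE : p = p./2.*2 by rewrite -[LHS]odd_double_half (negPf ep).
  apply: (IH p./2); [by lia | by lia | move=> n Nn].
  have k20 : kronecker a 2 != 0.
    by apply: contra_eq_neq kronecker2_sqr => ->; rewrite mulr0.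
  apply: (mulfI k20); rewrite -!kronecker_double doubleD -pE; apply: per.
  by rewrite -addnn; apply: leq_trans (leq_addr _ _).
have pert t n : (N <= n)%N -> kronecker a (n + p * t)%N%:Z = kronecker a n%:Z.
  move=> Nn; elim: t => [|t IHt]; first by rewrite muln0 addn0.
  by rewrite mulnSr addnA per // (leq_trans Nn) ?leq_addr.
(* This [n] is odd, at least [N] and prime to [a], so its symbol is nonzero and cannot equal its
   negative. *)
pose n := (2 * `|a| * N + 1)%N.
have on : odd n by rewrite /n -mulnA mul2n oddD odd_double.
have Nn : (N <= n)%N by rewrite /n; have := neq0_3mod4; nia.
have := pert (2 * `|a|)%N n Nn; rewrite mulnC kronecker_odd_period //.
rewrite -signr_odd op expr1 mulN1r => /eqP; rewrite eqNr => /eqP/kronecker_eq0.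
case=> [[n0]|]; first by rewrite n0 in on.
by rewrite absz_nat /n mulnAC gcdnC gcdnMDl gcdn1.
Qed.

(** Factors 2 are stripped from [r] and [2 ^ k] together. As [0 < r < 2 ^ k], [r] becomes odd while
    [k] is still positive; the shift is then an even multiple of [2|a|]. *)
Lemma kronecker_period (k r m t : nat) : (0 < r < 2 ^ k)%N ->
  kronecker a (2 ^ k * (m + 4 * `|a| * t) + r)%N%:Z
    = kronecker a (2 ^ k * m + r)%N%:Z.
Proof.
elim: k r => [|k IH] r /andP[r0 rk]; first by rewrite expn0 in rk; lia.
have [or|er] := boolP (odd r).
  have o : odd (2 ^ k.+1 * m + r) by rewrite oddD expnS -mulnA mul2n odd_double.
  have -> : (2 ^ k.+1 * (m + 4 * `|a| * t) + r
      = 2 ^ k.+1 * m + r + 2 * `|a| * (2 ^ k.+1 * t).*2)%N by rewrite -mul2n; lia.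
  by rewrite kronecker_odd_period // -signr_odd odd_double mul1r.
have rE : r = r./2.*2 by rewrite -[LHS]odd_double_half (negPf er).
have dE x : (2 ^ k.+1 * x + r = (2 ^ k * x + r./2).*2)%N.
  by rewrite expnS -mulnA mul2n {1}rE doubleD.
by rewrite !dE !kronecker_double IH //; move: rk; rewrite expnS; lia.
Qed.

End Kronecker.

(** * Finiteness of the 2-kernel and the mock character axioms *)

Theorem theorem3p6 (R : realType) (a : int) (ha : (a = 3 %[mod 4])%Z) :
  mock_character 2 (fun n : int => (kronecker a n)%:~R : R[i]).
Proof.
split.
- by split=> [|m n]; rewrite ?kronecker1 // kroneckerM // intrM.
- split=> //; pose M := (4 * `|a|)%N.
  have M0 : (0 < M)%N by have := neq0_3mod4 ha; rewrite /M; lia.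
  (* Two finite families cover the kernel: [sA] gives the symbol up to sign, [sB] the [M]-periodic
     sequences with values 0, 1, -1, coded by positions in that list. *)
  pose sA (c : bool) (m : nat) : R[i] := ((-1) ^+ c * kronecker a m)%:~R.
  pose sB (g : {ffun 'I_M -> 'I_3}) (m : nat) : R[i] :=
    (nth 0 [:: 0; 1; -1 : int] (g (Ordinal (ltn_pmod m M0))))%:~R.
  apply: (@sub_finite_set _ _
    ([set sA c | c in setT] `|` [set sB g | g in setT])%classic);
    last by rewrite finite_setU; split; apply: finite_image; exact: finite_finset.
  move=> _ [k [r [rk ->]]]; have [r0|r0] := posnP r.
    (* For [r = 0] the factor [2 ^ k] comes out as a power of the value at 2, which is 1 or -1. *)
    left; exists (kronecker a 2 ^+ k == -1) => //; apply/funext => m; rewrite /sA.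
    rewrite r0 addn0; congr (_%:~R).
    have -> : kronecker a (2 ^ k * m)%N = kronecker a 2 ^+ k * kronecker a m.
      rewrite PoszM kroneckerM //; congr (_ * _); elim: k {rk} => [|k IH].
        by rewrite kronecker1.
      by rewrite expnS PoszM kroneckerM // IH exprS.
    congr (_ * _).
    have /eqP : (kronecker a 2 ^+ k) ^+ 2 = 1.
      by rewrite exprAC expr2 kronecker2_sqr // expr1n.
    by rewrite sqrf_eq1 => /orP[] /eqP->.
  (* For [r > 0] the sequence is determined by its values on one period [M]. *)
  right; pose u m : int := kronecker a (2 ^ k * m + r)%N.
  exists [ffun i : 'I_M => inord (index (u i) [:: 0; 1; -1])] => //.
  apply/funext => m; rewrite /sB ffunE -[nat_of_ord (Ordinal _)]/(m %% M)%N.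
  have um : u m = u (m %% M)%N.
    have mE : m = (m %% M + 4 * `|a| * (m %/ M))%N by rewrite mulnC addnC -divn_eq.
    by rewrite /u [in LHS]mE kronecker_period // r0 rk.
  have := trit_kronecker ha (2 ^ k * (m %% M) + r)%N; rewrite -/(u _) /trit => tu.
  have iu : (index (u (m %% M)%N) [:: 0; 1; -1]%R < 3)%N by rewrite -index_mem in tu.
  by rewrite inordK // nth_index // -um.
- move=> [N [p [p0 per]]]; apply: (kronecker_not_periodic ha); exists N, p.
  by split=> // n /per/intr_inj.
- exists `|a|%N; split=> [|n]; first by rewrite absz_gt0 neq0_3mod4.
  rewrite -(kronecker_eq0 ha); split=> [/eqP|->//].
  by rewrite intr_eq0 => /eqP.
Qed.
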